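(* Let $d\ge 2$ be an integer, and let $\alpha,\beta>0$, $\theta\in\mathbb{R}\setminus\{0\}$, $\eta\in\mathbb{R}$. For $A,B\in\mathcal{M}(\mathbb{R}^d)$ and $z\in\mathbb{R}^d$ define $$x_1=J_{\alpha A}(z),\qquad x_2=J_{\beta B}\big((1+\beta/\alpha)x_1-(\beta/\alpha)z\big),$$ $$T(A,B,z)=z+\theta(x_2-x_1),\qquad S(A,B,z)=\eta x_1+(1-\eta)x_2 .$$ Then $(T,S)$ converges unconditionally for the problem class (2op-$\mathbb{R}^d$) if and only if $\alpha=\beta$ and $\theta\in(0,2)$.
   Context: $\mathcal{M}(\mathbb{R}^d)$ is the set of all maximal monotone (set-valued) operators on $\mathbb{R}^d$ (with the Euclidean inner product). For $A\in\mathcal{M}(\mathbb{R}^d)$ and $\alpha>0$, $J_{\alpha A}=(I+\alpha A)^{-1}:\mathbb{R}^d\to\mathbb{R}^d$ is the resolvent. For an operator $C$ on $\mathbb{R}^d$, $\operatorname{zer} C=\{x\in\mathbb{R}^d: 0\in Cx\}$. Problem class (2op-$\mathbb{R}^d$): all problems of finding $x\in\mathbb{R}^d$ with $0\in(A+B)x$, where $A,B\in\mathcal{M}(\mathbb{R}^d)$. Unconditional convergence: $(T,S)$ converges unconditionally for (2op-$\mathbb{R}^d$) if for all $A,B\in\mathcal{M}(\mathbb{R}^d)$ with $\operatorname{zer}(A+B)\neq\emptyset$ and every $z^0\in\mathbb{R}^d$, the sequence of iterates $z^{k+1}=T(A,B,z^k)$ converges, as $k\to\infty$, to some $z^\star\in\mathbb{R}^d$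 with $S(A,B,z^\star)\in\operatorname{zer}(A+B)$. *)

(* Defs.v *)
From HB Require Import structures.
From mathcomp Require Import all_boot all_order all_algebra.
From mathcomp Require Import all_classical all_reals all_analysis.

Set Implicit Arguments.
Unset Strict Implicit.
Unset Printing Implicit Defensive.

Import Order.TTheory GRing.Theory Num.Theory.
Import numFieldNormedType.Exports.

Local Open Scope classical_set_scope.
Local Open Scope ring_scope.

Section Operators.
Context {R : realType} {d : nat}.
Local Notation V := 'rV[R]_d.

Definition inner (u v : V) : R := \sum_(i < d) u 0 i * v 0 i.

(* Set-valued operators on R^d; [A x u] means that u belongs to A x. *)
Definition operator := V -> set V.

Definition op_id : operator := fun x => [set x].

Definition op_add (A B : operator) : operator :=
  fun x => [set u + v | u in A x & v in B x].

Definition op_scale (c : R) (A : operator) : operator :=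
  fun x => [set c *: u | u in A x].

Definition op_inv (A : operator) : operator := fun u => [set x | A x u].

Definition zer (A : operator) : set V := [set x | A x 0].

Definition monotone (A : operator) : Prop :=
  forall x y u v, A x u -> A y v -> 0 <= inner (u - v) (x - y).

Definition maximal_monotone (A : operator) : Prop :=
  monotone A /\
  forall B : operator, monotone B -> (forall x, A x `<=` B x) -> B = A.

(* (I + c A)^-1 as a function. For c > 0 and A maximal monotone, each
   (I + c A)^-1 z is a singleton (Minty), and [xget] returns its element; the
   default value 0 is only used when the set is empty. *)
Definition resolvent (c : R) (A : operator) (z : V) : V :=
  xget 0 (op_inv (op_add op_id (op_scale c A)) z).

Definition converges_unconditionally
    (T S : operator -> operator -> V -> V) : Prop :=
  forall A B : operator, maximal_monotone A -> maximal_monotone B ->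
  zer (op_add A B) !=set0 ->
  forall z0 : V, exists zs : V,
    (fun k : nat => iter k (T A B) z0) @ \oo --> zs /\
    zer (op_add A B) (S A B zs).

Section Splitting.
Variables (alpha beta theta eta : R).

Definition split_x1 (A : operator) (z : V) : V := resolvent alpha A z.

Definition split_x2 (A B : operator) (z : V) : V :=
  resolvent beta B
    ((1 + beta / alpha) *: split_x1 A z - (beta / alpha) *: z).

Definition split_T (A B : operator) (z : V) : V :=
  z + theta *: (split_x2 A B z - split_x1 A z).

Definition split_S (A B : operator) (z : V) : V :=
  eta *: split_x1 A z + (1 - eta) *: split_x2 A B z.

End Splitting.
End Operators.

(* Main.v *)
Require Import Defs.
From mathcomp Require Import all_boot all_order all_algebra.
From mathcomp Require Import all_classical all_reals all_analysis.
From mathcomp Require Import ring lra.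

Import Order.TTheory GRing.Theory Num.Theory.
Import numFieldNormedType.Exports.
Local Open Scope classical_set_scope.
Local Open Scope ring_scope.

(** Sufficiency is the convergence of Douglas--Rachford splitting. When the two
    step sizes agree, monotonicity of A and B makes T averaged: T shrinks the
    squared distance of two points by at least theta (2 - theta) times the
    squared distance of their residuals x2 - x1 ([dr_averaged]). A solution x
    with u in A x and - u in B x yields the point x + alpha u of zero residual,
    so the Krasnoselskii--Mann argument applies ([krasnoselskii_mann]): the
    iterates are bounded and Fejer monotone, their residuals tend to 0, hence a
    cluster point has zero residual and is the limit of the whole sequence. At
    the limit x1 = x2, and the inclusions defining the resolvents add up to
    0 in (A + B) x1.

    All this needs the resolvents to be defined everywhere, which is Minty's
    theorem ([minty]). It is derived from the Fitzpatrick function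
      F (x, u) = sup over v in A y of <x, v> + <y, u> - <y, v>,
    which is a supremum of affine functions, takes the value <y, v> at a point
    (y, v) of the graph, and is at least <x, u> everywhere when A is maximal.
    Hence F + |.|^2 / 2 is bounded below by |x + u|^2 / 2 and has a minimiser
    (x, u), at which - (x, u) is a subgradient of F ([sup_affine_prox]). The
    subgradient inequality at the points of the graph says that (- u, - x) is
    monotonically related to the graph, thus belongs to it, and then that
    u = - x. So - x is in A x, that is, 0 is in (I + A) x, and the general case
    follows by scaling and translating A.

    Necessity uses two explicit problems, in both of which T acts on the plane
    of a rotation K by a quarter turn as z |-> p z + q K z. As K z is
    orthogonal to z, iterates starting in that plane at a nonzero point do not
    converge when p^2 >= 1 and p <> 1 ([rotation_diverges]). The choice
    A = 0 and B the normal cone of {0} gives p = 1 - theta, q = 0, and so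
    0 < theta < 2 ([theta_bounds]). With gamma = beta / alpha, the choice
    alpha A = K and beta B = - s K gives
      p = 1 + theta (s - 1) (gamma - s) / (2 (1 + s^2)),
    which exceeds 1 for s strictly between 1 and gamma; the midpoint
    s = (1 + gamma) / 2 is available unless gamma = 1 ([stepsizes_eq]). *)

(** * The Euclidean inner product *)

Section Inner.
Context {R : realType} {n : nat}.
Implicit Types (u v w : 'rV[R]_n) (a : R).

Lemma innerC u v : inner u v = inner v u.
Proof. by apply: eq_bigr => i _; rewrite mulrC. Qed.

Lemma innerDl u v w : inner (u + v) w = inner u w + inner v w.
Proof. by rewrite -big_split; apply: eq_bigr => i _; rewrite mxE mulrDl. Qed.

Lemma innerZl a u v : inner (a *: u) v = a * inner u v.
Proof.
by rewrite /inner mulr_sumr; apply: eq_bigr => i _; rewrite mxE mulrA.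
Qed.

Lemma innerNl u v : inner (- u) v = - inner u v.
Proof. by rewrite -scaleN1r innerZl mulN1r. Qed.

Lemma innerDr u v w : inner w (u + v) = inner w u + inner w v.
Proof. by rewrite innerC innerDl !(innerC w). Qed.

Lemma innerZr a u v : inner v (a *: u) = a * inner v u.
Proof. by rewrite innerC innerZl innerC. Qed.

Lemma innerNr u v : inner v (- u) = - inner v u.
Proof. by rewrite innerC innerNl innerC. Qed.

Lemma inner0l u : inner 0 u = 0.
Proof. by rewrite -(scale0r 0) innerZl mul0r. Qed.

Definition innerE :=
  (innerDl, innerDr, innerNl, innerNr, innerZl, innerZr).

Lemma inner_ge0 u : 0 <= inner u u.
Proof. by apply: sumr_ge0 => i _; rewrite -expr2 sqr_ge0. Qed.

Lemma inner_eq0 u : inner u u <= 0 -> u = 0.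
Proof.
move=> u0; have /eqP : inner u u = 0 by apply/le_anti; rewrite u0 inner_ge0.
rewrite psumr_eq0 => [/allP u_eq0|i _]; last by rewrite -expr2 sqr_ge0.
apply/rowP => i; rewrite mxE; apply/eqP.
by have := u_eq0 i; rewrite mem_index_enum -expr2 sqrf_eq0 => /(_ isT).
Qed.

(** The norm `|u| is the supremum norm: this comparison transfers boundedness
    and convergence from the Euclidean distance to the topology of 'rV_n. *)
Lemma normr_sq_le_inner u : `|u| ^+ 2 <= inner u u.
Proof.
have [->|] := eqVneq `|u| 0; first by rewrite expr0n inner_ge0.
move=> /(@mx_norm_neq0 _ _ _ u) [[i j] /= uE].
have -> : `|u| = `|u i j| by rewrite -uE.
rewrite real_normK ?num_real// ord1 /inner (bigD1 j)//= -expr2 lerDl.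
by apply: sumr_ge0 => k _; rewrite -expr2 sqr_ge0.
Qed.

Lemma inner_sq_continuous : continuous (fun u => inner u u).
Proof.
apply: continuous_big => [|i _ u]; first exact: add_continuous.
have ci : {for u, continuous (fun v : 'rV[R]_n => v 0 i)}.
  exact: coord_continuous.
exact: (continuousM ci).
Qed.

Lemma sqdist_continuous w : continuous (fun u => inner (u - w) (u - w)).
Proof.
move=> u.
apply: (@continuous_comp _ _ _ (fun x : 'rV[R]_n => x - w)
  (fun x => inner x x)); last exact: inner_sq_continuous.
by apply: continuousB => //; exact: cst_continuous.
Qed.

(** Heine--Borel, phrased with Euclidean distances only, so that its users need
    no continuity of the functions they evaluate along u. *)
Lemma bounded_seq_cluster (u : nat -> 'rV[R]_n) w (C : R) :
  (forall k, inner (u k - w) (u k - w) <= C) ->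
  exists l, forall e, 0 < e ->
    forall N, exists k, (N <= k)%N /\ inner (u k - l) (u k - l) < e.
Proof.
move=> uC.
pose K := [set v : 'rV[R]_n | inner (v - w) (v - w) <= C].
have Kcompact : compact K.
  apply: bounded_closed_compact.
    exists (1 + C + `|w|); split; first exact: num_real.
    move=> M /ltW CM v; rewrite /K/= => vC; apply: le_trans CM.
    rewrite -lerBlDr; apply: le_trans (lerB_dist _ _) _.
    have := le_trans (normr_sq_le_inner (v - w)) vC.
    by have := normr_ge0 (v - w); nra.
  by have /continuous_closedP/(_ _ (@closed_le R C)) := sqdist_continuous w.
have [|l [_ ul]] := Kcompact (u @ \oo) (fmap_proper_filter _ _).
  by exists 0%N => // k _; exact: uC.
exists l => e e0 N.
have l_near : nbhs l [set v | inner (v - l) (v - l) < e].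
  have := sqdist_continuous l l; rewrite /continuous_at /= subrr inner0l => cl.
  exact: (@cvgr_lt _ _ _ _ _ _ cl).
have u_tail : (u @ \oo) [set u k | k in [set k | (N <= k)%N]].
  by exists N => // k Nk; exists k.
have [_ [[k Nk <-] lt_e]] := ul _ _ u_tail l_near.
by exists k.
Qed.

End Inner.

(** * Minimising a supremum of affine functions plus half the squared norm *)

Section SupAffine.
Context {R : realType} {n : nat} {I : Type}.
Variables (a : I -> 'rV[R]_n) (b : I -> R).

(** The supremum F of the affine functions [fun p => inner (a i) p - b i] is
    handled through its upper bounds, so that it may take the value +oo. The
    hypotheses say that F is finite somewhere and that F + |.|^2 / 2 >= 0. A
    minimising sequence of F + |.|^2 / 2 is bounded because one affine minorant
    of F already makes this function coercive; its cluster points p0 are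
    minimisers because every single affine function passes to the limit.
    Comparing p0 with p0 + t (q - p0) for small t > 0 then shows that - p0 is a
    subgradient of F at p0, where c stands for F p0. *)
Lemma sup_affine_prox :
  (exists p (t : R), forall i, inner (a i) p - b i <= t) ->
  (forall p (t : R),
    (forall i, inner (a i) p - b i + inner p p / 2 <= t) -> 0 <= t) ->
  exists p0 c, (forall i, inner (a i) p0 - b i <= c) /\
    forall q (s : R), (forall i, inner (a i) q - b i <= s) ->
      c - inner p0 (q - p0) <= s.
Proof.
move=> [p1 [c1 p1c1]] ge0.
have [i0 _] : exists i0 : I, True.
  apply/not_existsP => noI; suff: (0 : R) <= -1 by rewrite lerNr oppr0 ler10.
  by apply: (ge0 0) => i; case: (noI i).
pose S := [set t : R |
  exists p, forall i, inner (a i) p - b i + inner p p / 2 <= t].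
have S_inf : has_inf S.
  split; first by exists (c1 + inner p1 p1 / 2), p1 => i; rewrite lerD2r.
  by exists 0 => t [p /ge0].
set m := inf S.
have m_le (t : R) p :
    (forall i, inner (a i) p - b i + inner p p / 2 <= t) -> m <= t.
  by move=> pt; apply: ge_inf; [exact: S_inf.2|exists p].
have /choice [p pm] (k : nat) : exists p, forall i,
    inner (a i) p - b i + inner p p / 2 <= m + k.+1%:R^-1.
  have k0 : 0 < k.+1%:R^-1 :> R by rewrite invr_gt0.
  have [t [p pt] tm] := inf_adherent k0 S_inf.
  by exists p => i; apply: le_trans (pt i) (ltW tm).
have [k|p0 p0P] := @bounded_seq_cluster _ _ p (- a i0)
    (2 * (m + 1 + b i0) + inner (a i0) (a i0)).
  have := pm k i0; have : k.+1%:R^-1 <= 1 :> R by rewrite invf_le1// ler1n.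
  by rewrite !innerE (innerC (p k) (a i0)); set e := k.+1%:R^-1; lra.
have p0m i : inner (a i) p0 - b i + inner p0 p0 / 2 <= m.
  rewrite leNgt; apply/negP; set f := (X in m < X) => mf.
  pose W := inner (a i + p0) (a i + p0).
  have W0 : 0 <= W by exact: inner_ge0.
  have W2 : 0 < 2 + W by rewrite ltr_pwDl.
  (* If |p k - p0| and 1 / (k + 1) are below del, Young's inequality bounds the
     excess f - m by del (3 + W) / 2, which is less than del (2 + W). *)
  pose del := (f - m) / (2 + W).
  have del0 : 0 < del by rewrite divr_gt0// subr_gt0.
  have [N _ NP] := near_infty_natSinv_lt (PosNum del0).
  have [k [/NP/= kdel hk]] := p0P _ (exprn_gt0 2 del0) N.
  have pmk := pm k i.
  have delE : del * (2 + W) = f - m by rewrite divfK// gt_eqF.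
  pose Y := inner (a i + p0) (p k - p0).
  pose H := inner (p k - p0) (p k - p0).
  have YE : inner (a i) (p k) - b i + inner (p k) (p k) / 2 = f + Y + H / 2.
    by rewrite /f /Y /H !innerE !(innerC (p k)); field.
  have H0 : 0 <= H by exact: inner_ge0.
  have : 0 <= del ^+ 2 * W + 2 * del * Y + H.
    apply: le_trans (inner_ge0 (del *: (a i + p0) + (p k - p0))) _.
    rewrite (innerDl (del *: _)) !(innerDr (del *: _)) !innerZl !innerZr.
    rewrite (innerC (p k - p0) (a i + p0)) -/W -/Y -/H.
    lra.
  clear NP; move: pmk hk kdel; rewrite YE -/H.
  move: (k.+1%:R^-1) delE W0 H0 del0 => e.
  clearbody del Y H W f => delE W0 H0 del0 pmk hk kdel dY.
  have : - (del * (W + 1)) <= 2 * Y.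
    by rewrite -(ler_pM2l del0); nra.
  by have := mulr_ge0 (ltW del0) W0; lra.
exists p0, (m - inner p0 p0 / 2); split=> [i|q s qs].
  by have := p0m i; lra.
rewrite leNgt; apply/negP => sD.
pose H := inner (q - p0) (q - p0).
have H0 : 0 <= H by exact: inner_ge0.
pose D := m - inner p0 p0 / 2 - inner p0 (q - p0) - s.
have D0 : 0 < D by rewrite subr_gt0.
(* Any t in ]0, 1] with t H / 2 < D contradicts the minimality of m. *)
pose t : R := D / (D + H).
have DH0 : 0 < D + H by rewrite ltr_pwDl.
have tDH : t * (D + H) = D by rewrite divfK// gt_eqF.
have t0 : 0 < t by rewrite divr_gt0.
have t_le1 : t <= 1 by rewrite ler_pdivrMr// mul1r lerDl.
have : m <= m + t * (t * H / 2 - D).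
  apply: (m_le _ (p0 + t *: (q - p0))) => i.
  have -> : inner (p0 + t *: (q - p0)) (p0 + t *: (q - p0)) =
      inner p0 p0 + 2 * t * inner p0 (q - p0) + t ^+ 2 * H.
    by rewrite /H !innerE (innerC q p0); ring.
  have -> : inner (a i) (p0 + t *: (q - p0)) =
      (1 - t) * inner (a i) p0 + t * inner (a i) q.
    by rewrite !innerE; ring.
  have t1_ge0 : 0 <= 1 - t by rewrite subr_ge0.
  have := ler_wpM2l t1_ge0 (p0m i); have := ler_wpM2l (ltW t0) (qs i).
  rewrite /D.
  set u := inner (a i) p0; set v := inner (a i) q; set w := inner p0 (q - p0).
  set x := inner p0 p0 => le_s le_m; rewrite -subr_ge0.
  have -> : m + t * (t * H / 2 - (m - x / 2 - w - s)) -
      ((1 - t) * u + t * v - b i + (x + 2 * t * w + t ^+ 2 * H) / 2) =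
      (t * s - t * (v - b i)) + ((1 - t) * m - (1 - t) * (u - b i + x / 2)).
    by field.
  by rewrite addr_ge0// subr_ge0.
rewrite lerDl pmulr_rge0// subr_ge0 => D_le.
have := mulr_gt0 t0 D0; lra.
Qed.

End SupAffine.

(** * Minty's theorem *)

Section Minty.
Context {R : realType} {d : nat}.
Local Notation V := 'rV[R]_d.
Implicit Types (A : V -> set V) (x y z u v : V) (c : R).

Lemma inner_row_mx (n1 n2 : nat) (p p' : 'rV[R]_n1) (q q' : 'rV[R]_n2) :
  inner (row_mx p q) (row_mx p' q') = inner p p' + inner q q'.
Proof.
by rewrite /inner big_split_ord; congr (_ + _); apply: eq_bigr => i _;
  rewrite ?row_mxEl ?row_mxEr.
Qed.

(** Adding one point that is monotonically related to the graph gives a larger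
    monotone operator, so maximality can be tested point by point. *)
Lemma maximal_monotoneP A : maximal_monotone A <->
  Defs.monotone A /\ forall x u,
    (forall y v, A y v -> 0 <= inner (u - v) (x - y)) -> A x u.
Proof.
split=> -[monoA maxA].
  split=> // x u xuA.
  pose B : operator := fun y v => A y v \/ (y = x /\ v = u).
  suff <- : B = A by right.
  apply: maxA => [y y' v v'|y v]; last by left.
  move=> [Ayv|[-> ->]] [Ayv'|[-> ->]].
  - exact: monoA.
  - by rewrite -opprB -[y - x]opprB innerNl innerNr opprK; exact: xuA.
  - exact: xuA.
  - by rewrite subrr inner0l.
split=> // B monoB AB.
apply/funext => x; apply/seteqP; split=> u; last exact: AB.
by move=> Bxu; apply: maxA => y v /AB; exact: monoB.
Qed.

(** The pair (x, u) of the Fitzpatrick function is encoded as [row_mx x u], so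
    that the Euclidean structure of the product space is that of 'rV_(d + d). *)
Lemma minty_zero A : maximal_monotone A -> exists x, A x (- x).
Proof.
move=> /maximal_monotoneP[monoA maxA].
pose I := {yv : V * V | A yv.1 yv.2}.
pose a (i : I) := row_mx (sval i).2 (sval i).1.
pose b (i : I) := inner (sval i).1 (sval i).2.
have fitzpatrick_ge x u c :
    (forall i, inner (a i) (row_mx x u) - b i <= c) -> inner x u <= c.
  move=> Fc; rewrite leNgt; apply/negP => c_lt.
  have Axu : A x u.
    apply: maxA => y v Ayv.
    (* Otherwise <x - y, u - v> = <x, u> - (<x, v> + <y, u> - <y, v>) > 0. *)
    have := Fc (exist _ (y, v) Ayv).
    by rewrite /a /b inner_row_mx/= !innerE !(innerC v) !(innerC u); lra.
  have := Fc (exist _ (x, u) Axu).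
  by rewrite /a /b inner_row_mx/= (innerC u); lra.
have fitzpatrick_le y v : A y v ->
    forall i, inner (a i) (row_mx y v) - b i <= inner y v.
  move=> Ayv [[y' v'] /= Ayv']; rewrite /a /b inner_row_mx/=.
  have := monoA _ _ _ _ Ayv Ayv'.
  by rewrite !innerE !(innerC v) !(innerC v'); lra.
have [||p0 [c [Fp0 subgrad]]] := @sup_affine_prox R (d + d) I a b.
- have [[y [v Ayv]]|A0] := pselect (exists y v, A y v).
    by exists (row_mx y v), (inner y v); exact: fitzpatrick_le.
  suff A00 : A 0 0 by case: A0; exists 0, 0.
  by apply: maxA => y v Ayv; case: A0; exists y, v.
- move=> p t; rewrite -(hsubmxK p) inner_row_mx => Ft.
  set x := lsubmx p in Ft *; set u := rsubmx p in Ft *.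
  have := inner_ge0 (x + u).
  have /fitzpatrick_ge : forall i, inner (a i) (row_mx x u) - b i <=
      t - (inner x x + inner u u) / 2 by move=> i; rewrite lerBrDr.
  by rewrite !innerE (innerC u x); lra.
move: Fp0 subgrad; rewrite -(hsubmxK p0).
set x := lsubmx p0; set u := rsubmx p0 => /fitzpatrick_ge xu_c subgrad.
(* The subgradient inequality at (y, v), where F is <y, v>, together with
   F (x, u) >= <x, u>. *)
have graph_ge y v : A y v -> inner (x + u) (x + u) <= inner (- x - v) (- u - y).
  move=> Ayv; have := subgrad _ _ (fitzpatrick_le y v Ayv).
  rewrite opp_row_mx add_row_mx inner_row_mx !innerE.
  by rewrite (innerC u x) (innerC v u) (innerC v y); lra.
have Aux : A (- u) (- x).
  by apply: maxA => y v /graph_ge; exact/le_trans/inner_ge0.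
have := graph_ge _ _ Aux; rewrite subrr inner0l => /inner_eq0/eqP.
rewrite addr_eq0 => /eqP xu; exists x.
by rewrite {1}xu.
Qed.

(** [minty_zero] for the operator c A - z, which is maximal monotone with A. *)
Lemma minty A c z : maximal_monotone A -> 0 < c ->
  exists x, A x (c^-1 *: (z - x)).
Proof.
move=> /maximal_monotoneP[monoA maxA] c0.
have [|x] := @minty_zero (fun x w => A x (c^-1 *: (w + z))); last first.
  by exists x; rewrite addrC.
have c'0 : 0 < c^-1 by rewrite invr_gt0.
apply/maximal_monotoneP; split=> [x y u v Axu Ayv|x u xuA].
  have := monoA _ _ _ _ Axu Ayv.
  by rewrite -scalerBr innerZl pmulr_rge0// opprD addrACA subrr addr0.
apply: maxA => y v Ayv.
have -> : v = c^-1 *: ((c *: v - z) + z).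
  by rewrite subrK scalerA mulVf ?gt_eqF// scale1r.
rewrite -scalerBr innerZl pmulr_rge0// opprD addrACA subrr addr0.
by apply: xuA; rewrite subrK scalerA mulVf ?gt_eqF// scale1r.
Qed.

Lemma resolvent_unique A c x u : Defs.monotone A -> 0 < c -> A x u ->
  resolvent c A (x + c *: u) = x.
Proof.
move=> monoA c0 Axu; apply: xget_unique.
  by exists x => //; exists (c *: u) => //; exists u.
move=> y [_ -> [_ [v Ayv <-] eq_xy]].
have := monoA _ _ _ _ Ayv Axu.
have yxE : y - x = c *: (u - v).
  by apply/eqP; rewrite scalerBr subr_eq addrAC [_ + x]addrC -eq_xy addrK.
rewrite -(pmulr_rge0 _ c0) -innerZl -[v - u]opprB scalerN -yxE innerNl.
by rewrite oppr_ge0 => /inner_eq0/eqP; rewrite subr_eq0 => /eqP.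
Qed.

Lemma resolventP A c z : maximal_monotone A -> 0 < c ->
  A (resolvent c A z) (c^-1 *: (z - resolvent c A z)).
Proof.
move=> mA c0; have [x Axz] := minty _ _ z mA c0.
have := resolvent_unique _ _ _ _ mA.1 c0 Axz.
by rewrite scalerA mulfV ?gt_eqF// scale1r addrC subrK => ->.
Qed.

End Minty.

(** * Convergence of averaged iterations *)

Section KrasnoselskiiMann.
Context {R : realType} {d : nat}.
Local Notation V := 'rV[R]_d.

(** The squared distances of the iterates to w decrease to their infimum, and
    the decrease at each step is at least c times the squared residual, so the
    residuals tend to 0. As g is Lipschitz by the hypothesis, a cluster point
    zs has zero residual. The distances to zs then decrease too, and they come
    arbitrarily close to 0. *)
Lemma krasnoselskii_mann (theta c : R) (g : V -> V) (w z0 : V)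
    (T := fun z : V => z + theta *: g z) :
  0 < c -> g w = 0 ->
  (forall x y, inner (T x - T y) (T x - T y) +
    c * inner (g x - g y) (g x - g y) <= inner (x - y) (x - y)) ->
  exists zs, (fun k => iter k T z0) @ \oo --> zs /\ g zs = 0.
Proof.
move=> c0 gw T_averaged.
pose z k := iter k T z0.
have fejer v k : g v = 0 ->
    inner (z k.+1 - v) (z k.+1 - v) + c * inner (g (z k)) (g (z k)) <=
    inner (z k - v) (z k - v).
  move=> gv; have := T_averaged (z k) v.
  by have -> : T v = v; [rewrite /T gv scaler0 addr0|rewrite gv subr0].
have fejer_le v k N : g v = 0 -> (N <= k)%N ->
    inner (z k - v) (z k - v) <= inner (z N - v) (z N - v).
  move=> gv /subnK <-; elim: (k - N)%N => [//|m]; rewrite addSn.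
  apply: le_trans.
  apply: le_trans (fejer _ _ gv); rewrite lerDl.
  by rewrite mulr_ge0 ?inner_ge0 ?ltW.
have [k|zs zsP] := @bounded_seq_cluster _ _ z w (inner (z 0%N - w) (z 0%N - w)).
  exact: fejer_le.
have gzs : g zs = 0.
  apply/inner_eq0; rewrite leNgt; apply/negP => G0.
  set G := inner (g zs) (g zs) in G0.
  (* For k beyond some N and z k close to zs, both c |g (z k)|^2 and
     c |g (z k) - g zs|^2 are below e, while G is at most twice the sum of the
     two squares. *)
  pose e : R := c * G / 4.
  have e0 : 0 < e by rewrite divr_gt0// mulr_gt0.
  pose a := [set inner (z k - w) (z k - w) | k in [set: nat]].
  have a_inf : has_inf a.
    split; first by exists (inner (z 0%N - w) (z 0%N - w)), 0%N.
    by exists 0 => _ [k _ <-]; exact: inner_ge0.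
  have [_ [N _ <-] aN] := inf_adherent e0 a_inf.
  have [k [Nk zk]] := zsP _ e0 N.
  have inf_le : inf a <= inner (z k.+1 - w) (z k.+1 - w).
    by apply: ge_inf; [exact: a_inf.2|exists k.+1].
  have gk : c * inner (g (z k)) (g (z k)) < e.
    by have := fejer w k gw; have := fejer_le w k N gw Nk; lra.
  have gk_zs : c * inner (g (z k) - g zs) (g (z k) - g zs) < e.
    apply: le_lt_trans zk; apply: le_trans (T_averaged (z k) zs).
    by rewrite lerDr inner_ge0.
  have : G <= 2 * inner (g (z k)) (g (z k)) +
      2 * inner (g (z k) - g zs) (g (z k) - g zs).
    have := inner_ge0 (2 *: g (z k) - g zs).
    by rewrite /G !innerE (innerC (g zs) (g (z k))); lra.
  rewrite -(ler_pM2l c0) mulrDr ![c * (2 * _)]mulrCA.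
  have : c * G = 4 * e by rewrite /e; field.
  by lra.
exists zs; split => //; apply/cvgrPdist_le => e e0.
have [N [_ zN]] := zsP _ (exprn_gt0 2 e0) 0%N.
exists N => // k /= Nk.
rewrite distrC -ler_sqr ?nnegrE ?(ltW e0)//.
apply: le_trans (normr_sq_le_inner (z k - zs)) _.
by apply: le_trans (ltW zN); exact: fejer_le.
Qed.

End KrasnoselskiiMann.

(** * Douglas--Rachford splitting *)

Section Sufficiency.
Context {R : realType} {d : nat}.
Local Notation V := 'rV[R]_d.
Implicit Types (A B : V -> set V).

(** Stated for differences: z, x1, x2 are the differences of the corresponding
    points of two runs, and the hypotheses are the monotonicity of A and B
    multiplied by the step size. The gap between the two sides is exactly
    2 theta times the sum of the two hypotheses. *)
Lemma dr_averaged (theta : R) (z x1 x2 : V) : 0 <= theta ->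
  0 <= inner (z - x1) x1 -> 0 <= inner (2 *: x1 - z - x2) x2 ->
  inner (z + theta *: (x2 - x1)) (z + theta *: (x2 - x1)) +
    theta * (2 - theta) * inner (x2 - x1) (x2 - x1) <= inner z z.
Proof.
move=> theta0 mono1 mono2.
have : 0 <= 2 * theta * (inner (z - x1) x1 + inner (2 *: x1 - z - x2) x2).
  by rewrite !mulr_ge0// addr_ge0.
move=> /le_trans gap; rewrite -subr_ge0; apply: gap.
rewrite !innerE (innerC x1 z) (innerC x2 z) (innerC x2 x1).
by rewrite le_eqVlt; apply/orP; left; apply/eqP; ring.
Qed.

Lemma dr_converges (alpha theta eta : R) : 0 < alpha -> 0 < theta < 2 ->
  converges_unconditionally (d := d)
    (split_T alpha alpha theta) (split_S alpha alpha eta).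
Proof.
move=> alpha0 /andP[theta0 theta2] A B mA mB [xs [u Au [v Bv uv0]]] z0.
pose x1 := split_x1 alpha A; pose x2 := split_x2 alpha alpha A B.
have a1 : alpha / alpha = 1 by rewrite divff// gt_eqF.
have Ax1 z : A (x1 z) (alpha^-1 *: (z - x1 z)) by exact: resolventP.
have Bx2 z : B (x2 z) (alpha^-1 *: (2 *: x1 z - z - x2 z)).
  have := resolventP B alpha (2 *: x1 z - z) mB alpha0.
  by rewrite /x2 /split_x2 a1 scale1r.
pose g z := x2 z - x1 z.
have [|||zs [zs_lim gzs]] :=
    @krasnoselskii_mann R d theta (theta * (2 - theta)) g (xs + alpha *: u) z0.
- by rewrite mulr_gt0// subr_gt0.
- have x1E : x1 (xs + alpha *: u) = xs by exact: resolvent_unique mA.1 _ _.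
  have -> : g (xs + alpha *: u) = x2 (xs + alpha *: u) - xs by rewrite /g x1E.
  rewrite /x2 /split_x2 -/(x1 _) x1E a1 scale1r.
  have -> : (1 + 1) *: xs - (xs + alpha *: u) = xs + alpha *: v.
    move/eqP: uv0; rewrite addrC addr_eq0 => /eqP ->.
    by rewrite scalerDl scale1r opprD scalerN addrA addrK.
  by rewrite (resolvent_unique _ _ _ _ mB.1)// subrr.
- move=> x y.
  have alpha'0 : 0 < alpha^-1 by rewrite invr_gt0.
  have := mA.1 _ _ _ _ (Ax1 x) (Ax1 y); have := mB.1 _ _ _ _ (Bx2 x) (Bx2 y).
  rewrite -!scalerBr !innerZl !pmulr_rge0// => monoB monoA.
  have e1 : x - x1 x - (y - x1 y) = x - y - (x1 x - x1 y).
    by apply/rowP => i; rewrite !mxE; ring.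
  have e2 : 2 *: x1 x - x - x2 x - (2 *: x1 y - y - x2 y) =
      2 *: (x1 x - x1 y) - (x - y) - (x2 x - x2 y).
    by apply/rowP => i; rewrite !mxE; ring.
  have e3 : x + theta *: g x - (y + theta *: g y) =
      x - y + theta *: (x2 x - x2 y - (x1 x - x1 y)).
    by apply/rowP => i; rewrite !mxE; ring.
  have e4 : g x - g y = x2 x - x2 y - (x1 x - x1 y).
    by apply/rowP => i; rewrite !mxE; ring.
  rewrite {}e1 in monoA; rewrite {}e2 in monoB; rewrite {}e3 {}e4.
  exact: dr_averaged (ltW theta0) monoA monoB.
exists zs; split; first exact: zs_lim.
have x21 : x2 zs = x1 zs by apply/eqP; rewrite -subr_eq0; apply/eqP.
rewrite /split_S -/(x1 zs) -/(x2 zs) x21 -scalerDl addrC subrK scale1r.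
exists (alpha^-1 *: (zs - x1 zs)); first exact: Ax1.
exists (alpha^-1 *: (2 *: x1 zs - zs - x2 zs)).
  by rewrite -{1}x21; exact: Bx2.
rewrite x21 -scalerDr.
by apply/rowP => i; rewrite !mxE; ring.
Qed.

End Sufficiency.

(** * Two divergent families of problems *)

Section Necessity.
Context {R : realType} {d : nat}.
Local Notation V := 'rV[R]_d.

Lemma plane_rotation : (2 <= d)%N ->
  exists (K : 'M[R]_d) (e : V),
    [/\ forall x, inner (x *m K) x = 0, e *m K *m K = - e & e != 0].
Proof.
move=> d2; pose i := Ordinal (ltnW d2); pose j := Ordinal d2.
exists (delta_mx i j - delta_mx j i), (delta_mx 0 i); split.
- move=> x.
  have innerE' (u v : V) : inner u v = (u *m v^T) 0 0.
    by rewrite mxE; apply: eq_bigr => k _; rewrite mxE.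
  set K := _ - _.
  have KT : K^T = - K by rewrite linearB/= !trmx_delta opprB.
  have : inner (x *m K) x = - inner (x *m K) x.
    have trE (M : 'M[R]_1) : M 0 0 = M^T 0 0 by rewrite mxE.
    rewrite {1}innerE' trE !trmx_mul trmxK KT mulNmx mulmxN mulmxA mxE.
    by rewrite -innerE'.
  lra.
- have -> : delta_mx 0 i *m (delta_mx i j - delta_mx j i) = delta_mx 0 j :> V.
    by rewrite mulmxBr !mul_delta_mx_cond eqxx/= mulr1n mulr0n subr0.
  by rewrite mulmxBr !mul_delta_mx_cond eqxx/= mulr1n mulr0n sub0r.
- apply/eqP => /rowP/(_ i); rewrite !mxE !eqxx/= => /eqP.
  by rewrite oner_eq0.
Qed.

(** A point (x, u) related to the whole graph is tested against x + h with
    h = u - x K: the quadratic term in h vanishes by skewness, which leaves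
    - |h|^2 >= 0. *)
Lemma skew_maximal_monotone (K : 'M[R]_d) :
  (forall x : V, inner (x *m K) x = 0) ->
  maximal_monotone (fun x : V => [set x *m K]).
Proof.
move=> skewK; apply/maximal_monotoneP; split=> [x y _ _ -> ->|x u xu].
  by rewrite -mulmxBl skewK.
pose h := u - x *m K.
have := xu (x + h) _ erefl.
have -> : x - (x + h) = - h by rewrite opprD addNKr.
rewrite mulmxDl opprD addrA -/h innerDl !innerNr innerNl skewK !oppr0 addr0.
by rewrite oppr_ge0 => /inner_eq0/eqP; rewrite subr_eq0 => /eqP.
Qed.

(** This operator is the normal cone of {0}. A point (x, u) related to its graph
    is tested against (0, u + x), which leaves - |x|^2 >= 0. *)
Lemma normal_cone0_maximal_monotone :
  maximal_monotone (fun x : V => [set u : V | x = 0]).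
Proof.
apply/maximal_monotoneP; split=> [x y u v /= -> ->|x u xu].
  by rewrite subrr innerC inner0l.
have := xu 0 (u + x) erefl.
by rewrite opprD addNKr subr0 innerNl oppr_ge0 => /inner_eq0.
Qed.

(** The subspace of all z with z K K = - z is invariant under T, and T does not
    shorten its vectors when p^2 >= 1. Consecutive iterates then stay apart by
    at least |p - 1| |e|, so convergence forces p = 1. *)
Lemma rotation_diverges (K : 'M[R]_d) (e zs : V) (T : V -> V) (p q : R) :
  (forall x : V, inner (x *m K) x = 0) -> e *m K *m K = - e -> e != 0 ->
  (forall z, z *m K *m K = - z -> T z = p *: z + q *: (z *m K)) ->
  1 <= p ^+ 2 -> (fun k => iter k T e) @ \oo --> zs -> p = 1.
Proof.
move=> skewK Ke e0 TE p2 Tzs; pose z k := iter k T e.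
have sqE (a b : R) (x : V) :
    inner (a *: x + b *: (x *m K)) (a *: x + b *: (x *m K)) =
    a ^+ 2 * inner x x + b ^+ 2 * inner (x *m K) (x *m K).
  by rewrite !innerE (innerC x (x *m K)) skewK; ring.
have zP k : z k *m K *m K = - z k /\ inner e e <= inner (z k) (z k).
  elim: k => [//|k [Kz ez]]; rewrite /z iterS -/(z k) TE//; split.
    rewrite !mulmxDl -!scalemxAl Kz opprD -!scalerN; congr (_ + _ *: _).
    by rewrite mulNmx.
  apply: le_trans ez _; rewrite sqE.
  have := inner_ge0 (z k); have := inner_ge0 (z k *m K).
  have := sqr_ge0 q; nra.
have step0 : inner (z k.+1 - z k) (z k.+1 - z k) @[k --> \oo] --> (0 : R).
  have d0 : (fun k => z k.+1 - z k) @ \oo --> (0 : V).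
    rewrite -(subrr zs); apply: cvgB => //.
    by have := Tzs; rewrite -(cvg_shiftS z).
  rewrite -(@inner0l R d 0).
  exact: cvg_comp d0 (inner_sq_continuous _).
have step_ge k :
    (p - 1) ^+ 2 * inner e e <= inner (z k.+1 - z k) (z k.+1 - z k).
  have [Kz ez] := zP k; rewrite /z iterS -/(z k) TE//.
  have -> : p *: z k + q *: (z k *m K) - z k = (p - 1) *: z k + q *: (z k *m K).
    by rewrite scalerBl scale1r addrAC.
  rewrite sqE; apply: ler_wpDr; first by rewrite mulr_ge0 ?sqr_ge0 ?inner_ge0.
  by rewrite ler_wpM2l ?sqr_ge0.
have : (p - 1) ^+ 2 * inner e e <= 0.
  rewrite -(cvg_lim _ step0)//; apply: limr_ge.
    by apply/cvg_ex; exists 0.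
  by exists 0%N => // k _; exact: step_ge.
have e2 : 0 < inner e e.
  rewrite lt_neqAle inner_ge0 andbT eq_sym.
  by apply: contra_neq e0 => e2; apply: inner_eq0; rewrite e2.
rewrite pmulr_lle0// => p1; apply/eqP; rewrite -subr_eq0 -sqrf_eq0.
by rewrite eq_le p1 sqr_ge0.
Qed.

(** With A = 0 and B the normal cone of {0}, the resolvents are the identity
    and 0, hence T z = (1 - theta) z. *)
Lemma theta_bounds (alpha beta theta eta : R) :
  (2 <= d)%N -> 0 < alpha -> 0 < beta -> theta <> 0 ->
  converges_unconditionally (d := d)
    (split_T alpha beta theta) (split_S alpha beta eta) -> 0 < theta < 2.
Proof.
move=> d2 alpha0 beta0 theta_neq0 cv.
have [K [e [skewK Ke e0]]] := plane_rotation d2.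
pose A := fun x : V => [set x *m (0 : 'M[R]_d)].
pose B := fun x : V => [set u : V | x = 0].
have mA : maximal_monotone A.
  by apply: skew_maximal_monotone => x; rewrite mulmx0 inner0l.
have mB : maximal_monotone B by exact: normal_cone0_maximal_monotone.
have J_A z : resolvent alpha A z = z.
  rewrite -[in LHS](addr0 z) -(scaler0 _ alpha).
  by apply: resolvent_unique mA.1 _ _ => //; rewrite /A/= mulmx0.
have J_B z : resolvent beta B z = 0.
  rewrite -[in LHS](add0r z) -[z in LHS]scale1r.
  rewrite -(divff (lt0r_neq0 beta0)) -scalerA.
  exact: resolvent_unique mB.1 _ _.
have [|zs [Tzs _]] := cv A B mA mB _ e.
  by exists 0, 0; [rewrite /A/= mulmx0|exists 0 => //; rewrite addr0].
rewrite ltNge [theta < 2]ltNge -negb_or; apply/negP => theta_out.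
apply: theta_neq0; suff : 1 - theta = 1 by lra.
apply: (@rotation_diverges K e zs _ _ 0 skewK Ke e0 _ _ Tzs) => [z _|].
  rewrite /split_T /split_x2 /split_x1 J_A J_B sub0r scale0r addr0.
  by rewrite scalerBl scale1r scalerN.
by case/orP: theta_out => ?; nra.
Qed.

(** On the plane of K, where K K = - 1, the resolvents of K and - s K are
    (1 - K) / 2 and (1 + s K) / (1 + s^2). *)
Lemma stepsizes_eq (alpha beta theta eta : R) :
  (2 <= d)%N -> 0 < alpha -> 0 < beta -> 0 < theta ->
  converges_unconditionally (d := d)
    (split_T alpha beta theta) (split_S alpha beta eta) -> alpha = beta.
Proof.
move=> d2 alpha0 beta0 theta0 cv.
have [K [e [skewK Ke e0]]] := plane_rotation d2.
have mS (c : R) : maximal_monotone (fun x : V => [set x *m (c *: K)]).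
  by apply: skew_maximal_monotone => x; rewrite -scalemxAr innerZl skewK mulr0.
have alpha_neq0 := lt0r_neq0 alpha0; have beta_neq0 := lt0r_neq0 beta0.
pose gam : R := beta / alpha; pose s : R := (1 + gam) / 2.
pose A := fun x : V => [set x *m (alpha^-1 *: K)].
pose B := fun x : V => [set x *m ((- s / beta) *: K)].
have J_A z : z *m K *m K = - z ->
    resolvent alpha A z = 2^-1 *: (z - z *m K).
  move=> Kz; set x := RHS.
  have -> : z = x + alpha *: (x *m (alpha^-1 *: K)).
    rewrite -scalemxAr scalerA mulfV// scale1r /x -scalemxAl mulmxBl Kz.
    by apply/rowP => i; rewrite !mxE; field.
  exact: resolvent_unique (mS _).1 alpha0 _.
have s2 : 1 + s ^+ 2 != 0 by rewrite gt_eqF// ltr_pwDl// sqr_ge0.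
have J_B z : z *m K *m K = - z ->
    resolvent beta B z = (1 + s ^+ 2)^-1 *: (z + s *: (z *m K)).
  move=> Kz; set x := RHS.
  have -> : z = x + beta *: (x *m ((- s / beta) *: K)).
    rewrite -scalemxAr scalerA mulrCA mulfV// mulr1.
    rewrite /x -scalemxAl mulmxDl -scalemxAl Kz.
    by apply/rowP => i; rewrite !mxE; field.
  exact: resolvent_unique (mS _).1 beta0 _.
have [|zs [Tzs _]] := cv A B (mS _) (mS _) _ e.
  by exists 0, 0; [rewrite /A/= mul0mx|exists 0; rewrite ?addr0// /B/= mul0mx].
(* The coefficients of T on the plane, read off from the two resolvents. *)
pose p := 1 + theta * ((1 - gam) ^+ 2 / (8 * (1 + s ^+ 2))).
pose q := theta * ((s * (1 - gam) - (1 + gam)) / (2 * (1 + s ^+ 2)) + 2^-1).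
have p1 : p = 1.
  apply: (@rotation_diverges K e zs _ _ q skewK Ke e0 _ _ Tzs) => [z Kz|].
    rewrite /split_T /split_x2 /split_x1 J_A// -/gam J_B.
      rewrite !mulmxBl -!scalemxAl mulmxBl Kz.
      move: (z *m K) => y.
      apply/rowP => i; rewrite !mxE /p /q /s; field.
      by rewrite gt_eqF// ltr_pwDl// sqr_ge0.
    rewrite !(mulmxBl, =^~ scalemxAl, Kz, mulNmx).
    by apply/rowP => i; rewrite !mxE; ring.
  rewrite exprn_ege1// /p lerDl mulr_ge0 ?(ltW theta0)//.
  rewrite divr_ge0 ?sqr_ge0// mulr_ge0//.
  by rewrite addr_ge0// sqr_ge0.
have : theta * ((1 - gam) ^+ 2 / (8 * (1 + s ^+ 2))) = 0.
  by move: p1; rewrite /p; lra.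
move/eqP; rewrite !mulf_eq0 invr_eq0 mulf_eq0 (negPf s2) (gt_eqF theta0).
rewrite pnatr_eq0/= orbF orbb.
rewrite subr_eq0 => /eqP g1.
by rewrite -[beta](divfK alpha_neq0) -/gam -g1 mul1r.
Qed.

End Necessity.

(** * The characterisation *)

Theorem theorem2 (R : realType) (d : nat) (alpha beta theta eta : R)
    (d_ge2 : (2 <= d)%N) (alpha_gt0 : 0 < alpha) (beta_gt0 : 0 < beta)
    (theta_neq0 : theta <> 0) :
  converges_unconditionally (d := d)
    (split_T alpha beta theta) (split_S alpha beta eta)
  <-> (alpha = beta /\ 0 < theta < 2).
Proof.
split=> [cv|[<- theta_bd]]; last exact: dr_converges.
have theta_bd : 0 < theta < 2.
  exact: (theta_bounds _ _ _ _ d_ge2 alpha_gt0 beta_gt0 theta_neq0 cv).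
split=> //; case/andP: theta_bd => theta_gt0 _.
exact: (stepsizes_eq _ _ _ _ d_ge2 alpha_gt0 beta_gt0 theta_gt0 cv).
Qed.
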